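(* Let $\mathcal{H}_1,\mathcal{H}_2$ be real Hilbert spaces, let $A:\mathcal{H}_1\to\mathcal{H}_2$ be a bounded linear operator with $\|A\|>0$ and adjoint $A^*$, let $\alpha\ge 0$, and let $T:\mathcal{H}_2\to\mathcal{H}_2$ be an $\alpha$-SQNE operator with $\operatorname{im}A\cap\operatorname{Fix}T\ne\emptyset$. Let $V:\mathcal{H}_1\to\mathcal{H}_1$ be the Landweber-type operator $$V:=\mathrm{Id}+\frac{1}{\|A\|^2}A^*(T-\mathrm{Id})A,$$ and let its extrapolation $V_\tau:\mathcal{H}_1\to\mathcal{H}_1$ be defined by $$V_\tau x=\begin{cases}x+\dfrac{\|TAx-Ax\|^2}{\|A^*(TAx-Ax)\|^2}A^*(TAx-Ax), & \text{if } Ax\notin\operatorname{Fix}T,\\[2mm] x, & \text{otherwise.}\end{cases}$$ Then: (i) $\operatorname{Fix}V_\tau=\operatorname{Fix}V=A^{-1}(\operatorname{Fix}T)$; (ii) $V_\tau$ is $\alpha$-SQNE; (iii) if $\alpha>0$, then $V_\tau$ is asymptotically regular; (iv) if $T$ satisfies the demi-closedness principle, then $V_\tau$ also satisfies the demi-closedness principle.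
   Context: Operators are not assumed linear unless stated. $\mathrm{Id}$ is the identity operator, $\operatorname{im}A$ is the image of $A$, and $A^{-1}(\cdot)$ denotes the preimage under $A$. For an operator $S:\mathcal{H}\to\mathcal{H}$ on a real Hilbert space $\mathcal{H}$: - $\operatorname{Fix}S:=\{z\in\mathcal{H}: Sz=z\}$. - For $\alpha\ge0$, $S$ is $\alpha$-strongly quasi-nonexpansive ($\alpha$-SQNE) if $\operatorname{Fix}S\neq\emptyset$ and $\|Sx-z\|^2\le\|x-z\|^2-\alpha\|Sx-x\|^2$ for all $x\in\mathcal{H}$ and all $z\in\operatorname{Fix}S$. - $S$ is asymptotically regular if $\lim_{k\to\infty}\|S^{k+1}x-S^kx\|=0$ for all $x\in\mathcal{H}$. - $S$ satisfies the demi-closedness principle if, for every sequence $(x^k)$ in $\mathcal{H}$ and every $x\in\mathcal{H}$, weak convergence $x^k\rightharpoonup x$ together with $\|Sx^k-x^k\|\to0$ implies $x\in\operatorname{Fix}S$. *)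

(* Defs.v *)
From HB Require Import structures.
From mathcomp Require Import all_boot all_order all_algebra.
From mathcomp Require Import sesquilinear.
From mathcomp Require Import boolp classical_sets functions reals interval_inference.
From mathcomp Require Import topology normedtype sequences.
From mathcomp Require Import ring lra.

Set Implicit Arguments.
Unset Strict Implicit.
Unset Printing Implicit Defensive.

Import Order.TTheory GRing.Theory Num.Theory.
Import numFieldNormedType.Exports.

Local Open Scope classical_set_scope.
Local Open Scope ring_scope.

(* {dot H for idfun}: symmetric positive definite bilinear forms on H. *)
HB.mixin Record NormedModule_hasInner (R : realType) H of NormedModule R H := {
  inner : {dot H for @idfun R};
  norm_inner : forall x : H, `|x| = Num.sqrt (inner x x)
}.

#[short(type="hilbertType")]
HB.structure Definition Hilbert (R : realType) :=
  {H of CompleteNormedModule R H & NormedModule_hasInner R H}.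

Section InnerTheory.
Context {R : realType} {H : hilbertType R}.
Implicit Types x y z : H.

Lemma innerC x y : inner x y = inner y x :> R.
Proof. by rewrite hermC expr0 mul1r. Qed.

Lemma innerxx x : inner x x = `|x| ^+ 2 :> R.
Proof.
rewrite norm_inner sqr_sqrtr//; have [->|x0] := eqVneq x 0.
  by rewrite linear0l.
exact/ltW/neq0_dnorm_gt0.
Qed.

Lemma innerDl x y z : inner (x + y) z = inner x z + inner y z :> R.
Proof. exact: linearDl. Qed.

Lemma innerDr x y z : inner z (x + y) = inner z x + inner z y :> R.
Proof. exact: linearDr. Qed.

Lemma innerZl (a : R) x z : inner (a *: x) z = a * inner x z :> R.
Proof. exact: linearZl_LR. Qed.

Lemma innerZr (a : R) x z : inner z (a *: x) = a * inner z x :> R.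
Proof. exact: linearZr_LR. Qed.

Lemma sqr_normD x y :
  `|x + y| ^+ 2 = `|x| ^+ 2 + 2 * inner x y + `|y| ^+ 2 :> R.
Proof.
rewrite -!innerxx innerDl !innerDr (innerC y x); ring.
Qed.

Lemma sqr_normDZ x y (t : R) :
  `|x + t *: y| ^+ 2 = `|x| ^+ 2 + 2 * t * inner x y + t ^+ 2 * `|y| ^+ 2 :> R.
Proof. by rewrite sqr_normD innerZr -!innerxx innerZl innerZr; ring. Qed.

Lemma parallelogram x y :
  `|x - y| ^+ 2 = 2 * `|x| ^+ 2 + 2 * `|y| ^+ 2 - `|x + y| ^+ 2 :> R.
Proof.
have := sqr_normDZ x y (-1); have := sqr_normD x y.
by rewrite scaleN1r => -> ->; ring.
Qed.

Lemma cauchy_schwarz x y : `|inner x y : R| <= `|x| * `|y|.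
Proof.
have [->|y0] := eqVneq y 0; first by rewrite linear0r !normr0 mulr0.
have y1 : `|y| != 0 by rewrite normr_eq0.
rewrite -ler_sqr ?nnegrE ?mulr_ge0// exprMn real_normK ?num_real//.
have := sqr_ge0 (`|x + (- (inner x y / `|y| ^+ 2)) *: y|).
rewrite sqr_normDZ.
have -> : `|x| ^+ 2 + 2 * (- (inner x y / `|y| ^+ 2)) * inner x y +
    (- (inner x y / `|y| ^+ 2)) ^+ 2 * `|y| ^+ 2 =
  `|x| ^+ 2 - (inner x y : R) ^+ 2 / `|y| ^+ 2 by field.
by rewrite subr_ge0 ler_pdivrMr// exprn_gt0// normr_gt0.
Qed.

End InnerTheory.

Section Riesz.
Context {R : realType} {H : hilbertType R} (f : {linear H -> R^o}).
Hypothesis fb : bounded_fun_norm f.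

Let f_cont : continuous f.
Proof. exact/bounded_linear_continuous/bounded_funP. Qed.

Let fD x y : f (x + y) = f x + f y :> R.
Proof. exact: linearD. Qed.

Let fZ (a : R) x : f (a *: x) = a * f x :> R.
Proof. exact: linearZ. Qed.

Lemma min_norm_level1 : (exists x, f x != 0) ->
  exists2 z, f z = 1 & forall x, f x = 1 -> `|z| <= `|x|.
Proof.
move=> [x0 fx0].
pose D : set R := [set `|x| ^+ 2 | x in [set x : H | f x = 1]].
have fu : f ((f x0)^-1 *: x0) = 1 by rewrite fZ mulVf.
have infD : has_inf D.
  split; first by exists (`|(f x0)^-1 *: x0| ^+ 2), ((f x0)^-1 *: x0).
  by exists 0 => _ [x _ <-]; exact: sqr_ge0.
have ge_infD x : f x = 1 -> inf D <= `|x| ^+ 2.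
  by move=> fx; apply: ge_inf; [exact: infD.2|exists x].
have /choice[u uP] (n : nat) :
    exists x, f x = 1 /\ `|x| ^+ 2 < inf D + n.+1%:R^-1.
  have n0 : 0 < n.+1%:R^-1 :> R by rewrite invr_gt0.
  have [_ [x fx <-] xlt] := inf_adherent n0 infD.
  by exists x.
have udist n m : `|u n - u m| ^+ 2 <= 2 * (n.+1%:R^-1 + m.+1%:R^-1).
  have [fn ltn] := uP n; have [fm ltm] := uP m.
  have /ge_infD : f (2^-1 *: (u n + u m)) = 1.
    by rewrite fZ fD fn fm; field.
  rewrite normrZ exprMn gtr0_norm ?invr_gt0// => le_mid; rewrite parallelogram.
  have {le_mid} : inf D <= 4^-1 * `|u n + u m| ^+ 2.
    by rewrite (_ : 4^-1 = 2^-1 ^+ 2 :> R)//; field.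
  move: (`|u n + u m| ^+ 2) (`|u n| ^+ 2) (`|u m| ^+ 2) ltn ltm => a b c.
  by move: (inf D) (n.+1%:R^-1) (m.+1%:R^-1) => p q r; lra.
have ucvg : cvg (u @ \oo).
  apply/cauchy_cvgP/cauchy_exP => _/posnumP[e].
  have h0 : 0 < e%:num ^+ 2 / 4 :> R by rewrite divr_gt0// exprn_gt0.
  near \oo => n; exists (u n); rewrite fmapE; near=> m => /=.
  rewrite -ball_normE /= -ltr_sqr ?nnegrE//.
  apply: (le_lt_trans (udist n m)).
  have hn : n.+1%:R^-1 < e%:num ^+ 2 / 4 :> R.
    by near: n; exact: (near_infty_natSinv_lt (PosNum h0)).
  have hm : m.+1%:R^-1 < e%:num ^+ 2 / 4 :> R.
    by near: m; exact: (near_infty_natSinv_lt (PosNum h0)).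
  move: hn hm; move: (e%:num ^+ 2) (n.+1%:R^-1) (m.+1%:R^-1) => p q r; lra.
set z := lim (u @ \oo); exists z.
  have fuz : f (u n) @[n --> \oo] --> f z by apply: continuous_cvg => //; exact: f_cont.
  rewrite -(cvg_lim _ fuz)//; apply: cvg_lim => //.
  rewrite (_ : (fun n => f (u n)) = cst 1); first exact: cvg_cst.
  by apply/funext => n; rewrite (uP n).1.
move=> x fx; rewrite -ler_sqr ?nnegrE//; apply: le_trans (ge_infD _ fx).
have uz : `|u n| ^+ 2 @[n --> \oo] --> `|z| ^+ 2.
  by rewrite expr2; under eq_cvg do rewrite expr2; apply: cvgM; exact: cvg_norm.
have ud : inf D + n.+1%:R^-1 @[n --> \oo] --> inf D.
  rewrite -[X in _ --> X]addr0; apply: cvgD; [exact: cvg_cst|exact: cvg_harmonic].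
rewrite -(cvg_lim _ uz)// -(cvg_lim _ ud)//.
apply: ler_lim; [by apply/cvg_ex; eexists; exact: uz|by apply/cvg_ex; eexists; exact: ud|].
by apply: nearW => n; exact/ltW/(uP n).2.
Unshelve. all: by end_near. Qed.

Lemma riesz_representation : exists z, forall x, f x = inner x z.
Proof.
have [nf0|] := pselect (exists x, f x != 0); last first.
  move=> f0; exists 0 => x; rewrite linear0r; apply/eqP/negPn/negP => fx.
  by apply: f0; exists x.
have [z fz zmin] := min_norm_level1 nf0.
have orth v : f v = 0 -> inner z v = 0 :> R.
  move=> fv; have [->|v0] := eqVneq v 0; first by rewrite linear0r.
  have v2 : 0 < `|v| ^+ 2 by rewrite exprn_gt0// normr_gt0.
  pose t : R := - (inner z v / `|v| ^+ 2).
  have /zmin : f (z + t *: v) = 1 by rewrite fD fZ fv mulr0 addr0.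
  rewrite -ler_sqr ?nnegrE// sqr_normDZ /t => h.
  have : (inner z v) ^+ 2 / `|v| ^+ 2 <= 0.
    have v1 : `|v| != 0 by rewrite normr_eq0.
    have E : 2 * - (inner z v / `|v| ^+ 2) * inner z v +
       (- (inner z v / `|v| ^+ 2)) ^+ 2 * `|v| ^+ 2 =
       - ((inner z v) ^+ 2 / `|v| ^+ 2) by field.
    lra.
  by rewrite pmulr_lle0 ?invr_gt0// => h2; apply/eqP; rewrite -sqrf_eq0 eq_le h2 sqr_ge0.
have z0 : `|z| ^+ 2 != 0 :> R.
  rewrite sqrf_eq0 normr_eq0; apply: contra_eq_neq fz => ->.
  by rewrite linear0 eq_sym oner_neq0.
exists ((`|z| ^+ 2)^-1 *: z) => x.
have /orth : f (x - f x *: z) = 0.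
  by rewrite -scaleNr fD fZ fz mulr1 subrr.
rewrite -scaleNr innerDr innerZr innerxx mulNr => /eqP.
rewrite subr_eq0 => /eqP zx.
by rewrite innerZr innerC zx mulrCA mulVf ?mulr1.
Qed.

End Riesz.

Section Operators.
Context {R : realType} {H1 H2 : hilbertType R}.

(* The set is bounded above exactly when the linear map A is bounded; otherwise
   sup returns the junk value 0. *)
Definition opnorm (A : H1 -> H2) : R :=
  sup [set `|A x| | x in [set x : H1 | `|x| <= 1]].

(* The vector z exists (Riesz, see adjointP) and is unique for bounded linear A. *)
Definition adjoint (A : H1 -> H2) (y : H2) : H1 :=
  get [set z : H1 | forall x : H1, inner (A x) y = inner x z].

Lemma adjointP (A : {linear H1 -> H2}) : bounded_fun_norm A ->
  forall x y, inner (A x) y = inner x (adjoint A y).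
Proof.
move=> bA x y; move: x.
suff [z zP] : exists z : H1, forall x, inner (A x) y = inner x z.
  by rewrite /adjoint; case: xgetP => [_ _ //|/(_ z)].
pose f x : R^o := inner (A x) y.
have lf : linear f by move=> a u v; rewrite /f linearP innerDl innerZl.
pose F : {linear H1 -> R^o} := HB.pack f (GRing.isLinear.Build _ _ _ _ _ lf).
apply: (@riesz_representation _ _ F) => r.
have [M AM] := bA r; exists (M * `|y|) => x xr.
apply: le_trans (cauchy_schwarz _ _) _.
by rewrite ler_wpM2r// AM.
Qed.

End Operators.

Section NonlinearOperators.
Context {R : realType} {H : hilbertType R}.
Implicit Types S : H -> H.

Definition Fix S : set H := [set z | S z = z].

Definition SQNE (alpha : R) S :=
  Fix S !=set0 /\
  forall x z, Fix S z ->
    `|S x - z| ^+ 2 <= `|x - z| ^+ 2 - alpha * `|S x - x| ^+ 2.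

Definition asymptotically_regular S :=
  forall x, `|iter k.+1 S x - iter k S x| @[k --> \oo] --> (0 : R).

Definition weak_cvg (u : nat -> H) (x : H) :=
  forall y, inner (u k) y @[k --> \oo] --> (inner x y : R).

Lemma weak_cvgP (u : nat -> H) (x : H) : weak_cvg u x <->
  forall f : {linear H -> R^o}, bounded_fun_norm f ->
    f (u k) @[k --> \oo] --> f x.
Proof.
split=> [ux f bf|ux y].
  have [z fz] := riesz_representation bf.
  by rewrite fz; under eq_cvg do rewrite fz; exact: ux.
pose g v : R^o := inner v y.
have lg : linear g by move=> a v w; rewrite /g innerDl innerZl.
pose G : {linear H -> R^o} := HB.pack g (GRing.isLinear.Build _ _ _ _ _ lg).
apply: (ux G) => r; exists (r * `|y|) => v vr.
by apply: le_trans (cauchy_schwarz _ _) _; rewrite ler_wpM2r.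
Qed.

Definition demiclosedness_principle S :=
  forall (u : nat -> H) (x : H), weak_cvg u x ->
    `|S (u k) - u k| @[k --> \oo] --> (0 : R) -> Fix S x.

End NonlinearOperators.

Section Landweber.
Context {R : realType} {H1 H2 : hilbertType R}.
Variables (A : H1 -> H2) (T : H2 -> H2).

Definition landweber (x : H1) : H1 :=
  x + (opnorm A ^+ 2)^-1 *: adjoint A (T (A x) - A x).

Definition extrapolated_landweber (x : H1) : H1 :=
  if A x \notin Fix T then
    x + (`|T (A x) - A x| ^+ 2 / `|adjoint A (T (A x) - A x)| ^+ 2) *:
        adjoint A (T (A x) - A x)
  else x.

End Landweber.

(* Main.v *)
(* For [z] with [A z] in [Fix T], the [alpha]-SQNE inequality of [T] at [A x]
   reads [2 <x - z, g> <= - (1 + alpha) |d|^2] with [d = T (A x) - A x] and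
   [g = adjoint A d]. Hence [g = 0] forces [d = 0], which gives the fixed points.
   With [t = |d|^2 / |g|^2] one has [t |d|^2 = |t g|^2], so expanding
   [|x + t g - z|^2] gives [alpha]-SQNE. For demi-closedness,
   [|g| <= M |d|] gives [|d| <= M |d|^2 / |g| = M |Vtau x - x|]. *)
Require Import Defs.
From mathcomp Require Import all_boot all_order all_algebra.
From mathcomp Require Import boolp classical_sets functions reals.
From mathcomp Require Import topology normedtype sequences realfun.
From mathcomp Require Import ring lra.

Import Order.TTheory GRing.Theory Num.Theory.
Import numFieldNormedType.Exports.

Local Open Scope classical_set_scope.
Local Open Scope ring_scope.

Set Implicit Arguments.
Unset Strict Implicit.
Unset Printing Implicit Defensive.

Lemma cvg_sqr0 (R : realType) (u : nat -> R) :
  (u k) ^+ 2 @[k --> \oo] --> (0 : R) -> u k @[k --> \oo] --> (0 : R).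
Proof.
move=> u2; apply/norm_cvg0P; rewrite -[X in _ --> X]sqrtr0.
under eq_cvg do rewrite -sqrtr_sqr.
by apply: continuous_cvg => //; exact: sqrt_continuous.
Qed.

(** Fejér monotonicity: along the orbit, the squared distances to one fixed [z] decrease and hence
    converge, and [alpha^-1] times their successive drops dominates the squared increments. *)
Lemma SQNE_asymptotically_regular (R : realType) (H : hilbertType R)
    (alpha : R) (S : H -> H) :
  0 < alpha -> SQNE alpha S -> asymptotically_regular S.
Proof.
move=> alpha0 [[z Sz] qS] x; apply: cvg_sqr0.
pose a k : R := `|iter k S x - z| ^+ 2.
have aS k : `|iter k.+1 S x - iter k S x| ^+ 2 <= alpha^-1 * (a k - a k.+1).
  rewrite ler_pdivlMl//; have := qS (iter k S x) z Sz; rewrite /a iterS; lra.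
have a_cvg : cvgn a.
  apply: nonincreasing_is_cvgn.
    apply/nonincreasing_seqP => k; rewrite -subr_ge0.
    rewrite -(pmulr_rge0 _ (x := alpha^-1)) ?invr_gt0//.
    by apply: le_trans (aS k); exact: sqr_ge0.
  by exists 0 => _ [k _ <-]; exact: sqr_ge0.
have da : alpha^-1 * (a k - a k.+1) @[k --> \oo] --> (0 : R).
  rewrite -[X in _ --> X](mulr0 alpha^-1) -(subrr (limn a)).
  apply: cvgMr; apply: cvgB => //.
  by rewrite (cvg_shiftS a).
apply: squeeze_cvgr (cvg_cst 0) da; apply: nearW => k.
by rewrite sqr_ge0 aS.
Qed.

Section Adjoint.
Context {R : realType} {H1 H2 : hilbertType R} (A : {linear H1 -> H2}).
Hypothesis bA : bounded_fun_norm A.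

(** Testing [A (u k)] against [y] is testing [u k] against [adjoint A y]. *)
Lemma weak_cvg_linear (u : nat -> H1) (x : H1) :
  weak_cvg u x -> weak_cvg (A \o u) (A x).
Proof.
by move=> ux y; rewrite adjointP//; under eq_cvg do rewrite /= adjointP//; exact: ux.
Qed.

(** With g = [adjoint A y], one has |g|^2 = <A g, y> <= M |g| |y| for any bound M of [A]; then
    divide by |g|. *)
Lemma adjoint_bounded : exists2 M : R, 0 < M & forall y, `|adjoint A y| <= M * `|y|.
Proof.
have /bounded_funP/linear_boundedP/pinfty_ex_gt0[M M0 AM] := bA.
exists M => // y; have [->|g0] := eqVneq (adjoint A y) 0.
  by rewrite normr0 mulr_ge0// ltW.
rewrite -(ler_pM2l (x := `|adjoint A y|)) ?normr_gt0// -expr2 -innerxx -adjointP//.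
apply: le_trans (ler_norm _) _; apply: le_trans (cauchy_schwarz _ _) _.
by rewrite mulrCA mulrA ler_wpM2r.
Qed.

End Adjoint.

Section LandweberSQNE.
Context {R : realType} {H1 H2 : hilbertType R} (A : {linear H1 -> H2}).
Context {alpha : R} {T : H2 -> H2}.
Hypotheses (bA : bounded_fun_norm A) (alpha0 : 0 <= alpha) (qT : SQNE alpha T).
Hypothesis AT : range A `&` Fix T !=set0.

Lemma inner_landweber_le (x z : H1) : Fix T (A z) ->
  2 * inner (x - z) (adjoint A (T (A x) - A x)) <=
  - ((1 + alpha) * `|T (A x) - A x| ^+ 2).
Proof.
move=> /(qT.2 (A x)); rewrite -adjointP// [A (x - z)]linearB.
(* Expanding the square of this sum produces the inner product, and |A x - A z|^2 cancels. *)
have -> : T (A x) - A z = (A x - A z) + (T (A x) - A x) by rewrite [RHS]addrC addrA subrK.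
rewrite (sqr_normD (A x - A z)); lra.
Qed.

Lemma adjoint_residual_eq0 (x : H1) :
  adjoint A (T (A x) - A x) = 0 -> Fix T (A x).
Proof.
move=> g0; have [_ [[z _ <-] Tz]] := AT.
have := inner_landweber_le x Tz; rewrite g0 linear0r mulr0 oppr_ge0.
rewrite pmulr_rle0 ?ltr_pwDl// => d0; apply/eqP; rewrite -subr_eq0 -normr_eq0.
by rewrite -sqrf_eq0 eq_le d0 sqr_ge0.
Qed.

(** Shared by [landweber], whose step is a nonzero constant, and by [extrapolated_landweber], whose
    step vanishes where [A x] is fixed by [T]; hence the guarded condition on [t]. *)
Lemma Fix_scaled_residual (x : H1) (t : R) : (~ Fix T (A x) -> t != 0) ->
  x + t *: adjoint A (T (A x) - A x) = x <-> Fix T (A x).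
Proof.
move=> t0; split => [/eqP|Tx].
  rewrite -subr_eq0 addrAC subrr add0r scaler_eq0 => /orP[|/eqP/adjoint_residual_eq0//].
  by move=> t00; apply: contrapT => /t0; rewrite t00.
have -> : adjoint A (T (A x) - A x) = 0; last by rewrite scaler0 addr0.
(* [adjoint A 0 = 0] follows from |g|^2 = <A g, 0>, as [adjoint] is defined by choice. *)
rewrite Tx subrr; apply/eqP; rewrite -normr_eq0 -sqrf_eq0 -innerxx -adjointP//.
by rewrite linear0r.
Qed.

(** When [A x] is fixed by [T], the quotient is 0 / 0, which evaluates to 0, so one formula covers
    both cases. *)
Lemma extrapolated_landweberE x : extrapolated_landweber A T x =
  x + (`|T (A x) - A x| ^+ 2 / `|adjoint A (T (A x) - A x)| ^+ 2) *:
        adjoint A (T (A x) - A x).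
Proof.
rewrite /extrapolated_landweber; case: ifPn => // /negPn; rewrite inE => Tx.
by rewrite [X in X - _]Tx subrr normr0 expr0n mul0r scale0r addr0.
Qed.

Lemma step_neq0 x : ~ Fix T (A x) ->
  `|T (A x) - A x| ^+ 2 / `|adjoint A (T (A x) - A x)| ^+ 2 != 0.
Proof.
move=> Tx; rewrite mulf_neq0 ?invr_eq0// sqrf_eq0 normr_eq0.
  by rewrite subr_eq0; apply/eqP.
by apply/eqP => /adjoint_residual_eq0.
Qed.

Lemma Fix_extrapolated_landweber :
  Fix (extrapolated_landweber A T) = A @^-1` Fix T.
Proof.
apply/funext => x; apply/propext; rewrite /Fix /= extrapolated_landweberE.
by apply: Fix_scaled_residual; exact: step_neq0.
Qed.

Lemma Fix_landweber : opnorm A != 0 -> Fix (landweber A T) = A @^-1` Fix T.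
Proof.
move=> A0; have c0 : (opnorm A ^+ 2)^-1 != 0 by rewrite invr_eq0 sqrf_eq0.
by apply/funext => x; apply/propext; exact: Fix_scaled_residual.
Qed.

Lemma SQNE_extrapolated_landweber : SQNE alpha (extrapolated_landweber A T).
Proof.
have [_ [[z0 _ <-] Tz0]] := AT.
split; first by exists z0; rewrite Fix_extrapolated_landweber.
move=> x z; rewrite Fix_extrapolated_landweber => /= Tz.
have := inner_landweber_le x Tz; rewrite extrapolated_landweberE.
set d := T (A x) - A x; set g := adjoint A d => le_g.
have [d0|d0] := eqVneq (`|d| ^+ 2) 0.
  by rewrite d0 mul0r scale0r addr0 subrr normr0 expr0n mulr0 subr0.
have g0 : `|g| != 0.
  apply: contra_neq d0 => /normr0_eq0/adjoint_residual_eq0 Tx.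
  by rewrite /d Tx subrr normr0 expr0n.
set t := _ / _.
have t0 : 0 <= t by rewrite divr_ge0 ?sqr_ge0.
have tg : t * `|g| ^+ 2 = `|d| ^+ 2 by rewrite divfK ?sqrf_eq0.
rewrite (addrAC x _ (- x)) subrr add0r (addrAC x _ (- z)) sqr_normDZ normrZ (ger0_norm t0).
(* The cross term is at most -(1 + alpha) t^2 |g|^2; adding t^2 |g|^2 leaves -alpha |t g|^2. *)
have := ler_wpM2l t0 le_g; rewrite -tg; lra.
Qed.

Lemma demiclosedness_extrapolated_landweber : demiclosedness_principle T ->
  demiclosedness_principle (extrapolated_landweber A T).
Proof.
move=> dT u x ux Vu; rewrite Fix_extrapolated_landweber /=.
have [M M0 AM] := adjoint_bounded bA.
apply: dT (weak_cvg_linear bA ux) _.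
have MVu : M * `|extrapolated_landweber A T (u k) - u k| @[k --> \oo] --> (0 : R).
  by rewrite -(mulr0 M); apply: cvgMr.
apply: squeeze_cvgr (cvg_cst 0) MVu; apply: nearW => k /=; rewrite normr_ge0 /=.
rewrite extrapolated_landweberE addrAC subrr add0r normrZ.
set d := T _ - _.
(* The bound |d| <= M |Vtau (u k) - u k| divides by |g|, so d = 0 is treated apart. *)
have [->|d0] := eqVneq d 0; first by rewrite normr0 mulr_ge0// ?mulr_ge0// ltW.
have g0 : 0 < `|adjoint A d|.
  rewrite normr_gt0; apply: contra_neq d0 => /adjoint_residual_eq0 Tx.
  by rewrite /d /= Tx subrr.
rewrite ger0_norm ?divr_ge0 ?sqr_ge0//.
have -> : M * (`|d| ^+ 2 / `|adjoint A d| ^+ 2 * `|adjoint A d|) =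
    `|d| * (M * `|d|) / `|adjoint A d|.
  by field; rewrite gt_eqF.
by rewrite ler_pdivlMr// ler_wpM2l.
Qed.

End LandweberSQNE.

Theorem theorem8 (R : realType) (H1 H2 : hilbertType R)
    (A : {linear H1 -> H2}) (alpha : R) (T : H2 -> H2) :
  bounded_fun_norm A ->
  0 < opnorm A ->
  0 <= alpha ->
  SQNE alpha T ->
  range A `&` Fix T !=set0 ->
  let V := landweber A T in
  let Vtau := extrapolated_landweber A T in
  [/\ Fix Vtau = Fix V /\ Fix V = A @^-1` Fix T,
      SQNE alpha Vtau,
      (0 < alpha -> asymptotically_regular Vtau) &
      (demiclosedness_principle T -> demiclosedness_principle Vtau)].
Proof.
move=> bA A0 alpha0 qT AT V Vtau.
have FV := Fix_landweber bA alpha0 qT AT (lt0r_neq0 A0).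
have FVtau := Fix_extrapolated_landweber bA alpha0 qT AT.
have qVtau := SQNE_extrapolated_landweber bA alpha0 qT AT.
split.
- by rewrite /Vtau /V FVtau FV.
- exact: qVtau.
- by move=> alpha_gt0; exact: SQNE_asymptotically_regular alpha_gt0 qVtau.
- exact: demiclosedness_extrapolated_landweber bA alpha0 qT AT.
Qed.
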